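(* Let $n\ge 3$ be an integer and let $G^+_n=\langle a,b,c \mid cb^n=b^na,\ ab=bc,\ ac=ca\rangle_{mo}$, with $\deg$ the word length. Its skew growth function is $$N_{G^{+}_n,\deg}(t)=(1-t)\,(t^{n+2}+t^{n+1}-2t+1).$$
   Context: $\langle L\mid R\rangle_{mo}$ denotes the monoid presented by a finite set of generators $L$ and relations $R$, i.e. the quotient of the free monoid $L^*$ by the congruence generated by $R$. All relations equate words of equal length, so the length of words gives a well-defined homomorphism $\deg:M\to\mathbb{Z}_{\ge 0}$. The monoid considered here is cancellative. Let $M=\langle L\mid R\rangle_{mo}$ be such a monoid. For $u,v\in M$ write $u|_l v$ if $v=ux$ for some $x\in M$. For a subset $J\subset M$ put $\mathrm{cm}_r(J)=\{u\in M: j|_l u \text{ for all } j\in J\}$, $\mathrm{min}_r(J)=\{u\in J: \text{every } v\in J \text{ with } v|_l u \text{ equals } u\}$, and $\mathrm{mcm}(J)=\mathrm{min}_r(\mathrm{cm}_r(J))$. A tower of $M$ of height $p\in\mathbb{Z}_{\ge0}$ is a sequence $T=(I_0,J_1,\dots,J_p)$ of subsets of $M$, where $I_0$ is the image of $L$ in $M$, such that, putting $I_k:=\mathrm{mcm}(J_k)$, for each $k=1,\dots,p$ one has $J_k\subset I_{k-1}$, $1<\#J_k<\infty$ and $I_k\neq\emptyset$. Put $|T|:=I_p$. $\mathrm{Tmcm}(M)$ is the set of all towers (including the height-$0$ tower $(I_0)$). The skew growth function is the formal power series $$N_{M,\deg}(t)=1+\sum_{T=(I_0,J_1,\dots,J_p)\in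 \mathrm{Tmcm}(M)}(-1)^{\#J_1+\cdots+\#J_p-p+1}\sum_{\Delta\in|T|}t^{\deg(\Delta)}.$$ *)

(* Defs.v *)
From HB Require Import structures.
From mathcomp Require Import all_boot all_algebra finmap.
From mathcomp Require Import generic_quotient zify.
From mathcomp Require Import boolp classical_sets functions cardinality fsbigop.

Set Implicit Arguments.
Unset Strict Implicit.
Unset Printing Implicit Defensive.

Import GRing.Theory.

Local Open Scope classical_set_scope.
Local Open Scope ring_scope.
Local Open Scope quotient_scope.

Record presentation := Presentation {
  letters : finType;
  relations : seq (seq letters * seq letters);
  relations_homogeneous : all (fun r => size r.1 == size r.2) relations }.

Section PresentedMonoid.
Variable P : presentation.
Implicit Types u v w : seq (letters P).

Inductive congruent : seq (letters P) -> seq (letters P) -> Prop :=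
| congruent_rel u v : (u, v) \in relations P -> congruent u v
| congruent_refl u : congruent u u
| congruent_sym u v : congruent u v -> congruent v u
| congruent_trans u v w : congruent u v -> congruent v w -> congruent u w
| congruent_cat u u' v v' :
    congruent u v -> congruent u' v' -> congruent (u ++ u') (v ++ v').

(* Classical decision of the congruence, so that the quotient exists. *)
Definition congruentb u v : bool := `[< congruent u v >].

Lemma congruentb_refl : reflexive congruentb.
Proof. by move=> u; apply/asboolP/congruent_refl. Qed.

Lemma congruentb_sym : symmetric congruentb.
Proof. by move=> u v; apply/asboolP/asboolP; exact: congruent_sym. Qed.

Lemma congruentb_trans : transitive congruentb.
Proof.
by move=> v u w /asboolP uv /asboolP vw; apply/asboolP/(congruent_trans uv).
Qed.

Canonical congruentb_equiv :=
  EquivRel congruentb congruentb_refl congruentb_sym congruentb_trans.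

Definition presented : Type := {eq_quot congruentb}.
HB.instance Definition _ := Choice.on presented.
HB.instance Definition _ := EqQuotient.on presented.

Definition of_word (w : seq (letters P)) : presented := \pi_presented w.

Lemma of_wordP u v : of_word u = of_word v <-> congruent u v.
Proof.
split=> [/eqP|uv]; first by rewrite /of_word eqmodE => /asboolP.
by apply/eqP; rewrite /of_word eqmodE; apply/asboolP.
Qed.

Lemma of_word_repr (x : presented) : of_word (repr x) = x.
Proof. exact: reprK. Qed.

Definition presented_one : presented := of_word [::].
Definition presented_mul (x y : presented) : presented :=
  of_word (repr x ++ repr y).

Lemma of_word_cat u v :
  presented_mul (of_word u) (of_word v) = of_word (u ++ v).
Proof.
by apply/of_wordP; apply: congruent_cat; apply/of_wordP; rewrite of_word_repr.
Qed.

Lemma presented_mulA : associative presented_mul.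
Proof.
move=> x y z; rewrite -(of_word_repr x) -(of_word_repr y) -(of_word_repr z).
by rewrite !of_word_cat catA.
Qed.

Lemma presented_mul1 : left_id presented_one presented_mul.
Proof. by move=> x; rewrite -(of_word_repr x) of_word_cat. Qed.

Lemma presented_mulr1 : right_id presented_one presented_mul.
Proof. by move=> x; rewrite -(of_word_repr x) of_word_cat cats0. Qed.

HB.instance Definition _ := isMonoid.Build presented
  presented_mulA presented_mul1 presented_mulr1.

Lemma of_wordM u v : of_word (u ++ v) = (of_word u * of_word v)%g.
Proof. by rewrite -of_word_cat. Qed.

Lemma congruent_size u v : congruent u v -> size u = size v.
Proof.
elim=> {u v} [u v uv|//|//|u v w _ -> //|u u' v v' _ + _].
  by have /allP/(_ _ uv)/eqP := relations_homogeneous P.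
by rewrite !size_cat => -> ->.
Qed.

(* Independent of the representative, see [deg_of_word]. *)
Definition deg (x : presented) : nat := size (repr x).

Lemma deg_of_word w : deg (of_word w) = size w.
Proof. by apply/congruent_size/of_wordP; rewrite of_word_repr. Qed.

Lemma deg1 : deg 1%g = 0%N. Proof. exact: deg_of_word. Qed.

Lemma degM (x y : presented) : deg (x * y)%g = (deg x + deg y)%N.
Proof.
rewrite -(of_word_repr x) -(of_word_repr y) -of_wordM.
by rewrite !deg_of_word size_cat.
Qed.

Definition generators : set presented := [set of_word [:: l] | l in setT].

End PresentedMonoid.

Section CommonMultiples.
Variable M : monoidType.

(* [ldvd v u] reads "v divides u from the left", i.e. u belongs to v M. *)
Definition ldvd (v u : M) : Prop := exists x : M, u = (v * x)%g.

Definition cm_r (J : set M) : set M := [set u | forall j, J j -> ldvd j u].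

Definition min_r (J : set M) : set M :=
  [set u | J u /\ forall v, J v -> ldvd v u -> v = u].

Definition mcm (J : set M) : set M := min_r (cm_r J).

End CommonMultiples.

Section Towers.
Variable P : presentation.
Notation M := (presented P).

(* A tower (I_0, J_1, ..., J_p) is encoded by the sequence of its finite sets
   J_1, ..., J_p, since I_0 is always the set of generators; J_k is stored at
   index k - 1, and [level T k] is I_k. *)
Definition level (T : seq {fset M}) (k : nat) : set M :=
  if k is k'.+1 then mcm [set` nth fset0 T k'] else @generators P.

Definition Tmcm : set (seq {fset M}) :=
  [set T | forall k, (k < size T)%N ->
    [/\ [set` nth fset0 T k] `<=` level T k,
        (1 < #|` nth fset0 T k|)%N
      & level T k.+1 !=set0]].

Definition tower_top (T : seq {fset M}) : set M := level T (size T).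

(* The subtraction does not truncate on towers: each J_k has at least two
   elements. *)
Definition tower_sign (T : seq {fset M}) : int :=
  (-1) ^+ (\sum_(J <- T) #|` J| - size T + 1)%N.

(* A formal power series is given by its sequence of coefficients: this is the
   coefficient of t^d. Both sums have finite support, see [finite_towers] and
   [finite_deg] below. *)
Definition skew_growth (d : nat) : int :=
  (d == 0%N)%:R +
  \sum_(T \in Tmcm) tower_sign T * \sum_(D \in tower_top T) ((deg D == d)%:R : int).

Lemma finite_bounded_seq (X : choiceType) (F : set X) (d : nat) :
  finite_set F ->
  finite_set [set s : seq X | (size s <= d)%N /\ forall x, x \in s -> F x].
Proof.
move=> finF; elim: d => [|d IHd].
  apply: (@sub_finite_set _ _ [set [::]]); last exact: finite_set1.
  by move=> [|x s] [].
set S := [set s | _] in IHd.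
have finS : finite_set ([set [::]] `|` [set x :: s | x in F & s in S]).
  by rewrite finite_setU; split; [exact: finite_set1|exact: finite_image2].
apply: sub_finite_set finS => -[|x s] [/= les sF]; first by left.
right; exists x; first by apply: sF; rewrite mem_head.
exists s => //; split=> // y ys; apply: sF.
by rewrite in_cons ys orbT.
Qed.

Lemma finite_deg_le (d : nat) : finite_set [set x : M | (deg x <= d)%N].
Proof.
have finT : finite_set [set: letters P] by exact: finite_finset.
have := finite_image (@of_word P) (finite_bounded_seq d finT).
apply: sub_finite_set => x /= xd.
by exists (repr x); [split|exact: of_word_repr].
Qed.

Lemma finite_deg (d : nat) : finite_set [set x : M | deg x = d].
Proof. by apply: sub_finite_set (finite_deg_le d) => x /= ->. Qed.

Lemma ldvd_deg (u v : M) : ldvd u v -> (deg u <= deg v)%N.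
Proof. by move=> [x ->]; rewrite degM leq_addr. Qed.

Lemma ldvd_deg_eq (u v : M) : ldvd u v -> (deg v <= deg u)%N -> u = v.
Proof.
move=> [x ->]; rewrite degM -[leqRHS]addn0 leq_add2l leqn0 => /nilP x0.
by rewrite -(of_word_repr x) x0 mulg1.
Qed.

Lemma deg_level (T : seq {fset M}) (k : nat) (u : M) :
  Tmcm T -> (k <= size T)%N -> level T k u -> (k < deg u)%N.
Proof.
move=> towT; elim: k u => [|k IHk] u /= ksz.
  by move=> [l _ <-]; rewrite deg_of_word.
move=> [uJ _]; have [Jsub J1 _] := towT _ ksz.
have degJ v : v \in nth fset0 T k -> (k < deg v)%N.
  by move=> vJ; apply: IHk (ltnW ksz) (Jsub _ vJ).
have [v vJ vu] : exists2 v, v \in nth fset0 T k & v != u.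
  apply: contrapT => nv; move: J1; rewrite ltnNge => /negP; apply.
  rewrite -(cardfs1 u); apply/fsubset_leq_card/fsubsetP => v vJ.
  by rewrite inE; apply/negP => /negP vu; apply: nv; exists v.
apply: leq_ltn_trans (degJ _ vJ) _; rewrite ltnNge; apply/negP => uv.
by move/eqP: vu; apply; apply: ldvd_deg_eq uv; apply: uJ.
Qed.

Lemma deg_tower (T : seq {fset M}) (D : M) (k : nat) (v : M) :
  Tmcm T -> tower_top T D -> (k < size T)%N -> v \in nth fset0 T k ->
  (deg v <= deg D)%N.
Proof.
move=> towT topD.
have degJ i w : level T i.+1 w -> (deg w <= deg D)%N ->
    forall u, u \in nth fset0 T i -> (deg u <= deg D)%N.
  by move=> [wJ _] wD u uJ; apply: leq_trans wD; apply/ldvd_deg/wJ.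
suff H m : (m < size T)%N ->
    forall u, u \in nth fset0 T (size T - m.+1) -> (deg u <= deg D)%N.
  move=> ksz vk; apply: (H (size T - k.+1)%N); first by lia.
  by have -> : (size T - (size T - k.+1).+1 = k)%N by lia.
elim: m => [|m IHm] msz.
  by apply: degJ (leqnn _); rewrite subn1 prednK.
have eqm : (size T - m.+1 = (size T - m.+2).+1)%N by lia.
have [Jsub J1 _] : [/\ [set` nth fset0 T (size T - m.+1)]
      `<=` level T (size T - m.+1),
    (1 < #|` nth fset0 T (size T - m.+1)|)%N
    & level T (size T - m.+1).+1 !=set0].
  by apply: towT; rewrite ltn_subrL (leq_ltn_trans _ msz).
have [w wJ] : exists w, w \in nth fset0 T (size T - m.+1).
  by apply/fset0Pn; rewrite -cardfs_gt0 ltnW.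
apply: (degJ _ w); first by rewrite -eqm; apply: Jsub.
by apply: IHm wJ; exact: ltnW.
Qed.

Lemma finite_towers (d : nat) :
  finite_set [set T | Tmcm T /\ exists2 D, tower_top T D & deg D = d].
Proof.
have finJ : finite_set [set J : {fset M} | [set` J] `<=` [set x | (deg x <= d)%N]].
  apply: sub_finite_set (finite_fset (fpowerset (fset_set [set x : M | (deg x <= d)%N]))) => J Jd.
  rewrite /= fpowersetE; apply/fsubsetP => x /Jd xd.
  by rewrite in_fset_set ?inE //; exact: finite_deg_le.
apply: sub_finite_set (finite_bounded_seq d finJ) => T [towT [D topD <-]].
split=> [|J /(nthP fset0)[k ksz <-] v /= vJ]; last exact: deg_tower vJ.
exact/ltnW/(deg_level towT (leqnn _) topD).
Qed.

End Towers.

Section Gplus.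
Variable n : nat.

Definition ga : 'I_3 := @Ordinal 3 0 isT.
Definition gb : 'I_3 := @Ordinal 3 1 isT.
Definition gc : 'I_3 := @Ordinal 3 2 isT.

Definition Gplus_relations : seq (seq 'I_3 * seq 'I_3) :=
  [:: (gc :: nseq n gb, rcons (nseq n gb) ga);
      ([:: ga; gb], [:: gb; gc]);
      ([:: ga; gc], [:: gc; ga])].

Lemma Gplus_homogeneous :
  all (fun r => size r.1 == size r.2) Gplus_relations.
Proof. by rewrite /= size_rcons eqxx. Qed.

Definition Gplus : presentation := Presentation Gplus_homogeneous.

End Gplus.

(* Main.v *)
(* Write a = a_1 and c = a_0. The map b |-> rotation, a_i |-> a_i identifies the
   monoid with a submonoid of the semidirect product of the trace monoid of the
   (n+1)-cycle (with a_i and a_(i+1) commuting) by the powers of b acting by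
   rotation: ab = bc and c b^n = b^n a say that b a_i = a_(i+1) b, and ac = ca is
   the commutation. In this model an element is left divisible by a, resp. c, iff
   the label a_1, resp. a_0, can be commuted to the front of its trace.
   With u_i = a^i c b^n this gives mcm {a,b} = {ab}, mcm {a,c} = {ac},
   mcm {b,c} = {u_i | i >= 0}, mcm {a,b,c} = {u_i | i >= 1}, and
   mcm {u_i | i in S} = {u_(max S) b} for finite S with at least two elements, so
   that no tower has height 3. The height 1 towers contribute 2t^2 + t^(n+1). In
   height 2, the signed sums over all S of given maximum k, over {b,c} and over
   {a,b,c}, cancel each other except for k = 1, where the only tower is
   S = {0,1} over {b,c}; it contributes - t^(n+3). *)

Require Import Defs.
From mathcomp Require Import all_boot all_algebra finmap zify ring.
From mathcomp Require Import boolp classical_sets functions cardinality fsbigop.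

Set Implicit Arguments.
Unset Strict Implicit.
Unset Printing Implicit Defensive.

Import GRing.Theory.
Local Open Scope ring_scope.

(** * Signed sums over subsets of a finite set *)

(** Expand the product over all i of 1 - [i in A]: a choice set S contributes (-1)^#S inside A and 0
    otherwise, while a single element of A makes the product vanish. *)
Lemma sum_sign_subsets (T : finType) (A : {set T}) :
  \sum_(S : {set T} | S \subset A) (-1) ^+ #|S| = (A == finset.set0)%:R :> int.
Proof.
have := bigA_distr 1 +%R (fun i => - (i \in A)%:R : int) (fun=> 1).
rewrite (bigID (fun S : {set T} => S \subset A)) /= [X in _ + X]big1 => [|S]; last first.
  case/fintype.subsetPn => i iS iA; rewrite (bigD1 i) //= iS (negPf iA).
  by rewrite oppr0 mul0r.
rewrite addr0 => E; transitivity (\prod_(i : T) (1 - (i \in A)%:R : int)).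
  rewrite (eq_bigr _ (fun i _ => addrC _ _)) E; apply: eq_bigr => S SA.
  rewrite -big_mkcond /= -prodr_const; apply: eq_bigr => i iS.
  by rewrite (fintype.subsetP SA).
have [->|/finset.set0Pn[i iA]] := eqVneq A finset.set0.
  by apply: big1 => i _; rewrite inE subr0.
by rewrite (bigD1 i) //= iA subrr mul0r.
Qed.

Lemma sum_sign_nonempty_subsets (T : finType) (A : {set T}) :
  \sum_(S : {set T} | (S \subset A) && (S != finset.set0)) (-1) ^+ #|S| =
  (A == finset.set0)%:R - 1 :> int.
Proof.
rewrite -sum_sign_subsets [in RHS](bigD1 finset.set0) ?finset.sub0set //= cards0 expr0.
by rewrite addrAC subrr add0r.
Qed.

(** * Traces over a cycle *)

Section Traces.
Variable n : nat.
Implicit Types (i j : 'I_n.+1) (s t : seq 'I_n.+1).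
Local Open Scope nat_scope.

Lemma val_ordS i : ordS i = (if i == n :> nat then 0 else i.+1) :> nat.
Proof.
rewrite /=; case: eqP => [->|/eqP ni]; first by rewrite modnn.
by rewrite modn_small // ltnS ltn_neqAle ni -ltnS ltn_ord.
Qed.

(* Adjacent labels commute: traces are words over the vertices of the
   (n+1)-cycle up to this partial commutation. *)
Definition adjacent i j := (j == ordS i) || (i == ordS j).

Lemma adjacent_ordS i j : adjacent (ordS i) (ordS j) = adjacent i j.
Proof. by rewrite /adjacent !(inj_eq (@ordS_inj _)). Qed.

(* Two words represent the same trace iff they have the same projections to
   every pair of non-commuting letters. *)
Definition trace_eq s t :=
  forall i j, ~~ adjacent i j -> filter (pred2 i j) s = filter (pred2 i j) t.

(* The first occurrence of j can be commuted to the front of s. *)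
Fixpoint front j s : bool :=
  if s is x :: s' then (x == j) || adjacent x j && front j s' else false.

(** The right-hand side involves only the projections compared by [trace_eq], so being in front is
    an invariant of the trace. *)
Lemma frontP (n_gt0 : 0 < n) j s :
  front j s <->
  forall i, ~~ adjacent i j -> exists t, filter (pred2 i j) s = j :: t.
Proof.
elim: s => [|x s IHs] /=.
  split=> // /(_ j); case=> //.
  (* The cycle has at least two vertices, so j is not adjacent to itself and the pair (j, j) is
     admissible. *)
  have : ordS j != j.
    by apply/eqP => /(congr1 (@nat_of_ord _)); rewrite val_ordS; case: eqP; lia.
  by rewrite /adjacent eq_sym => /negPf ->.
case: eqVneq => [->|xj] /=.
  by split=> // _ i _; rewrite orbT; eexists.
case: (boolP (adjacent x j)) => [adj|nadj] /=; last first.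
  split=> // /(_ x nadj)[t]; rewrite eqxx /= => -[E].
  by rewrite E eqxx in xj.
rewrite IHs; split=> H i nij; have [t tE] := H i nij; exists t; move: tE.
  by case: eqVneq => [xi|//]; rewrite xi (negPf nij) in adj.
by case: eqVneq => [xi|//]; rewrite xi (negPf nij) in adj.
Qed.

Lemma front_trace_eq (n_gt0 : 0 < n) j s t :
  trace_eq s t -> front j s = front j t.
Proof.
move=> st; apply/idP/idP => /(frontP n_gt0) H; apply/(frontP n_gt0) => i nij.
  by rewrite -st //; apply: H.
by rewrite st //; apply: H.
Qed.

Lemma trace_eq_cons x s t : trace_eq (x :: s) (x :: t) <-> trace_eq s t.
Proof.
split=> H i j nij; have := H i j nij; rewrite /=; last by move=> ->.
by case: ifP => // _ [].
Qed.

Lemma trace_eq_catl s t t' : trace_eq (s ++ t) (s ++ t') -> trace_eq t t'.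
Proof. by elim: s => //= x s IHs /trace_eq_cons. Qed.

Lemma trace_eq_cat s s' t t' :
  trace_eq s t -> trace_eq s' t' -> trace_eq (s ++ s') (t ++ t').
Proof. by move=> st st' i j nij; rewrite !filter_cat st // st'. Qed.

Lemma trace_eq_shift s t :
  trace_eq (map (@ordS _) s) (map (@ordS _) t) <-> trace_eq s t.
Proof.
have pre i j s0 : filter (pred2 (ordS i) (ordS j)) (map (@ordS _) s0)
    = map (@ordS _) (filter (pred2 i j) s0).
  rewrite filter_map; congr map; apply: eq_filter => x /=.
  by rewrite !(inj_eq (@ordS_inj _)).
split=> H i j nij.
  apply: (inj_map (@ordS_inj _)); rewrite -!pre; apply: H.
  by rewrite adjacent_ordS.
rewrite -(ord_predK i) -(ord_predK j) !pre H //.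
by rewrite -adjacent_ordS !ord_predK.
Qed.

Lemma front_shift j s : front (ordS j) (map (@ordS _) s) = front j s.
Proof.
by elim: s => //= x s ->; rewrite adjacent_ordS (inj_eq (@ordS_inj _)).
Qed.

End Traces.

(** * The monoid as a monoid of traces *)

Section GplusMonoid.
Variable n : nat.
Hypothesis n_ge3 : (3 <= n)%N.
Local Notation M := (presented (Gplus n)).
Local Notation word := (seq 'I_3).
Implicit Types (u v w : word) (x y z : M) (i k : nat).
Local Open Scope group_scope.

Definition ma : M := @of_word (Gplus n) [:: ga].
Definition mb : M := @of_word (Gplus n) [:: gb].
Definition mc : M := @of_word (Gplus n) [:: gc].

Lemma of_word_nseq (l : 'I_3) k :
  @of_word (Gplus n) (nseq k l) = (@of_word (Gplus n) [:: l]) ^+ k.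
Proof. by elim: k => [//|k IHk]; rewrite expgS -IHk -of_wordM. Qed.

Lemma mulab : ma * mb = mb * mc.
Proof.
rewrite -!of_wordM; apply/of_wordP/congruent_rel.
by rewrite !inE eqxx ?orbT.
Qed.

Lemma mulac : ma * mc = mc * ma.
Proof.
rewrite -!of_wordM; apply/of_wordP/congruent_rel.
by rewrite !inE eqxx ?orbT.
Qed.

Lemma mulcbn : mc * mb ^+ n = mb ^+ n * ma.
Proof.
rewrite -!of_word_nseq -!of_wordM; apply/of_wordP/congruent_rel.
by rewrite !inE cats1 eqxx.
Qed.

Lemma mulacX i k : ma ^+ i * mc ^+ k = mc ^+ k * ma ^+ i.
Proof. exact/commuteX2/mulac. Qed.

Lemma mulaXb i : ma ^+ i * mb = mb * mc ^+ i.
Proof.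
elim: i => [|i IHi]; first by rewrite !expg0 mulg1 mul1g.
by rewrite expgS -mulgA IHi mulgA mulab -mulgA -expgS.
Qed.

Lemma presented_ind (P : M -> Prop) :
  P 1 -> (forall x, P x -> P (ma * x)) -> (forall x, P x -> P (mb * x)) ->
  (forall x, P x -> P (mc * x)) -> forall x, P x.
Proof.
move=> P1 Pa Pb Pc x; rewrite -(of_word_repr x).
elim: (repr x : word) => [//|l w IHw].
rewrite -cat1s of_wordM; case: l => -[|[|[|//]]] l3.
- by rewrite (_ : Ordinal l3 = ga); [exact: Pa|exact: val_inj].
- by rewrite (_ : Ordinal l3 = gb); [exact: Pb|exact: val_inj].
- by rewrite (_ : Ordinal l3 = gc); [exact: Pc|exact: val_inj].
Qed.

Variant presented_spec x : Prop :=
| PresentedOne of x = 1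
| PresentedA of exists y, x = ma * y
| PresentedB of exists y, x = mb * y
| PresentedC of exists y, x = mc * y.

Lemma presentedP x : presented_spec x.
Proof.
elim/presented_ind: x => [|x _|x _|x _]; first exact: PresentedOne.
- by apply: PresentedA; exists x.
- by apply: PresentedB; exists x.
- by apply: PresentedC; exists x.
Qed.

(** * The semidirect product model and its invariance under the relations *)

Definition nb w : nat := count_mem gb w.

(* Pushing every b to the right rotates the labels that it passes; [labels w] is
   the trace part of the image of w in the semidirect product. *)
Fixpoint labels w : seq 'I_n.+1 :=
  if w is l :: w' then
    if l == ga then ordS ord0 :: labels w'
    else if l == gb then map (@ordS _) (labels w') else ord0 :: labels w'
  else [::].

Definition model_eq u v : Prop := nb u = nb v /\ trace_eq (labels u) (labels v).

Lemma nb_cat u v : nb (u ++ v) = (nb u + nb v)%N.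
Proof. exact: count_cat. Qed.

Definition shift k (s : seq 'I_n.+1) := iter k (map (@ordS _)) s.

Lemma shiftS k s : shift k.+1 s = map (@ordS _) (shift k s).
Proof. by []. Qed.

(** The multiplication rule of the semidirect product: the b's of [u] act on the labels of [v] by
    rotation. *)
Lemma labels_cat u v : labels (u ++ v) = labels u ++ shift (nb u) (labels v).
Proof.
rewrite /nb; elim: u => //= l u IHu; rewrite IHu.
case: (eqVneq l ga) => [El|_]; first by rewrite El.
by case: eqVneq => _ //=; rewrite map_cat.
Qed.

Lemma trace_eq_shiftn k s t : trace_eq (shift k s) (shift k t) <-> trace_eq s t.
Proof. by elim: k => // k IHk; rewrite !shiftS trace_eq_shift. Qed.

Lemma iter_ordS k (i : 'I_n.+1) : (i + k <= n)%N -> iter k (@ordS _) i = (i + k)%N :> nat.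
Proof.
elim: k => [|k IHk] ik; first by rewrite addn0.
by rewrite iterS val_ordS IHk; [case: eqP; lia|lia].
Qed.

Lemma shift1 k (i : 'I_n.+1) : shift k [:: i] = [:: iter k (@ordS _) i].
Proof. by elim: k => // k IHk; rewrite shiftS IHk. Qed.

Lemma labels_nseqb k : labels (nseq k gb) = [::].
Proof. by elim: k => //= k ->. Qed.

Lemma model_eq_relations u v : (u, v) \in Gplus_relations n -> model_eq u v.
Proof.
rewrite !inE => /or3P[] /eqP[-> ->].
- rewrite -cats1; split; first by rewrite nb_cat addn0.
  rewrite labels_cat /= labels_nseqb shift1 /nb count_nseq /= mul1n.
  (* The label 1 of a is rotated n times by b^n; in total 0 makes n + 1 steps, a full turn, and
     becomes the label 0 of c. *)
  rewrite -iterSr iterS (_ : ordS _ = ord0) //; apply: ord_inj.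
  by rewrite val_ordS iter_ordS // add0n eqxx.
- by [].
- split=> // i j nij /=; set c1 := ordS _; set c0 := ord0.
  have adj1 : adjacent c0 c1 by rewrite /adjacent eqxx.
  have adj2 : adjacent c1 c0 by rewrite /adjacent eqxx orbT.
  move: c1 c0 adj1 adj2 => c1 c0 adj1 adj2.
  (* The order matters only if both labels survive the projection to i and j. They are then equal,
     or they are i and j, contradicting non-adjacency. *)
  case E1: (_ || _); case E0: (_ || _) => //.
  case/orP: E1 => /eqP e1; case/orP: E0 => /eqP e0.
  + by rewrite e1 e0.
  + by rewrite e1 e0 (negPf nij) in adj2.
  + by rewrite e1 e0 (negPf nij) in adj1.
  + by rewrite e1 e0.
Qed.

Lemma congruent_model_eq u v : @congruent (Gplus n) u v -> model_eq u v.
Proof.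
elim=> {u v} [u v|u|u v _ [? uv]|u v w _ [E uv] _ [E' vw]
            |u u' v v' _ [E uv] _ [E' vw]].
- exact: model_eq_relations.
- by [].
- by split=> // i j nij; rewrite uv.
- by split=> [|i j nij]; [rewrite E|rewrite uv // vw].
- split; first by rewrite !nb_cat E E'.
  by rewrite !labels_cat E; apply: trace_eq_cat => //; apply/trace_eq_shiftn.
Qed.

Definition frontM (j : 'I_n.+1) (x : M) : bool := front j (labels (repr x)).
Definition nbM (x : M) : nat := nb (repr x).

Lemma model_eq_repr w : model_eq (repr (@of_word (Gplus n) w)) w.
Proof. by apply/congruent_model_eq/of_wordP; rewrite of_word_repr. Qed.

Let n_gt0 : (0 < n)%N := ltn_trans (isT : (0 < 2)%N) n_ge3.

(** Makes [frontM] independent of the representative chosen in its definition. *)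
Lemma frontM_of_word j w : frontM j (@of_word (Gplus n) w) = front j (labels w).
Proof. by have [_ E] := model_eq_repr w; apply: front_trace_eq. Qed.

Lemma nbM_of_word w : nbM (@of_word (Gplus n) w) = nb w.
Proof. by have [E _] := model_eq_repr w. Qed.

Let l0 : 'I_n.+1 := ord0.
Let l1 : 'I_n.+1 := ordS ord0.

Lemma frontM_a j x : frontM j (ma * x) = (l1 == j) || adjacent l1 j && frontM j x.
Proof. by rewrite -(of_word_repr x) -of_wordM !frontM_of_word. Qed.

Lemma frontM_c j x : frontM j (mc * x) = (l0 == j) || adjacent l0 j && frontM j x.
Proof. by rewrite -(of_word_repr x) -of_wordM !frontM_of_word. Qed.

Lemma frontM_b j x : frontM (ordS j) (mb * x) = frontM j x.
Proof. by rewrite -(of_word_repr x) -of_wordM !frontM_of_word front_shift. Qed.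

Lemma frontM1 j : frontM j 1 = false.
Proof. by rewrite frontM_of_word. Qed.

Lemma nbMM x y : nbM (x * y) = (nbM x + nbM y)%N.
Proof.
by rewrite -(of_word_repr x) -(of_word_repr y) -of_wordM !nbM_of_word nb_cat.
Qed.

Lemma val_l1 : l1 = 1%N :> nat.
Proof. by rewrite /l1 val_ordS /= ltn_eqF. Qed.

(* How an element having label j in front factors. For j = 2, ..., n - 1 the
   exponent i vanishes; for j = n a power of c may precede b^(n-1) a, which makes
   mcm {b, c} infinite. *)
Definition front_shape (j : nat) (x : M) : Prop :=
  match j with
  | 0 => exists y, x = mc * y
  | 1 => exists y, x = ma * y
  | k.+2 => exists i y, x = mc ^+ i * mb ^+ k.+1 * ma * y /\
                        (k.+2 == n \/ i = 0%N)
  end.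

(** Induction on the first letter of x. If a or c is not itself the front letter, its label is
    adjacent to j and j is in front of the rest; behind b, the front label is the predecessor of j.
    The relations then move the letter past the known shape. *)
Lemma front_shapeP x (j : 'I_n.+1) : frontM j x -> front_shape j x.
Proof.
elim/presented_ind: x j => [|x IHx|x IHx|x IHx] j.
- by rewrite frontM1.
- rewrite frontM_a => /orP[/eqP <-|/andP[adj /IHx]]; first by rewrite val_l1; exists x.
  (* The neighbours of the label 1 of a. *)
  have [->|->] : j = 0%N :> nat \/ j = 2%N :> nat.
  + case/orP: adj => /eqP /(congr1 (@nat_of_ord _)); rewrite val_ordS val_l1.
      by case: ifP; [lia|right].
    by case: ifP => [|_ []]; [lia|left].
  + by case=> y ->; exists (ma * y); rewrite !mulgA mulac.
  (* Since n is not 2, no power of c occurs, and a b a = b c a = b a c. *)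
  + case=> i [y [-> [|->]]]; first by move/eqP; lia.
    exists 0%N, (mc * y); split; last by right.
    rewrite !expg0 !mul1g !expg1 !mulgA mulab.
    by rewrite -(mulgA mb ma mc) mulac mulgA.
- move=> Hf.
  have Hf' : frontM (ord_pred j) x by rewrite -frontM_b ord_predK.
  have := IHx _ Hf'.
  have := congr1 (@nat_of_ord _) (ord_predK j); rewrite val_ordS.
  have := ltn_ord (ord_pred j); move: (nat_of_ord (ord_pred j)) => p pn.
  case: eqP => [-> <-|pn' <-].
  + have [m Em] : exists m, n = m.+2 by exists n.-2; lia.
    move=> Hs; have {Hs} : front_shape m.+2 x by rewrite -Em.
    (* Wrapping round from n to 0: b c^i b^(n-1) a = a^i b^n a = a^i c b^n = c a^i b^n. *)
    case=> i [y [-> _]]; exists (ma ^+ i * mb ^+ n * y).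
    rewrite !mulgA -mulaXb -(mulgA _ mb) -expgS -Em -(mulgA _ _ ma) -mulcbn.
    by rewrite !mulgA -[mc in RHS]expg1 -mulacX.
  + case: p pn pn' => [|[|p]] pn pn'.
    * by case=> y ->; exists (mb * y); rewrite !mulgA mulab.
    * case=> y ->; exists 0%N, y; split; last by right.
      by rewrite mul1g expg1 mulgA.
    * case=> i [y [-> [/eqP|i0]]]; first by lia.
      exists 0%N, y; split; last by right.
      by rewrite i0 !expg0 !mul1g [in RHS]expgS !mulgA.
- rewrite frontM_c => /orP[/eqP <-|/andP[adj /IHx]]; first by exists x.
  have [->|->] : j = 1%N :> nat \/ j = n :> nat.
  + case/orP: adj => /eqP /(congr1 (@nat_of_ord _)); rewrite val_ordS.
      by rewrite (ltn_eqF (n_gt0 : (l0 < n)%N)); left.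
    by case: ifP => [/eqP|//]; right.
  + by case=> y ->; exists (mc * y); rewrite !mulgA mulac.
  + have [m Em] : exists m, n = m.+2 by exists n.-2; lia.
    have E z : front_shape n z = front_shape m.+2 z by rewrite -Em.
    rewrite !E.
    (* Label 0 is adjacent to label n but c is not moved past b^(n-1), so the powers of c pile up
       here. *)
    case=> i [y [-> _]]; exists i.+1, y; split; last by left; rewrite Em.
    by rewrite [mc ^+ i.+1]expgS !mulgA.
Qed.

Lemma front0P x : frontM l0 x -> exists y, x = mc * y.
Proof. exact: front_shapeP. Qed.

Lemma front1P x : frontM l1 x -> exists y, x = ma * y.
Proof. by move/front_shapeP; rewrite val_l1. Qed.

Lemma front2P x : frontM (ordS l1) x -> exists y, x = mb * ma * y.
Proof.
move/front_shapeP; rewrite val_ordS val_l1; case: eqP => [|_]; first by lia.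
case=> i [y [-> [|->]]]; first by move/eqP; lia.
by exists y; rewrite expg0 mul1g expg1.
Qed.

Lemma frontnP x : frontM ord_max x ->
  exists i y, x = mc ^+ i * mb ^+ n.-1 * ma * y.
Proof.
have [m Em] : exists m, n = m.+2 by exists n.-2; lia.
move/front_shapeP => /= H; have {H} : front_shape m.+2 x by rewrite -Em.
by case=> i [y [-> _]]; exists i, y; rewrite (_ : n.-1 = m.+1) // Em.
Qed.

Definition modelM x y : Prop :=
  nbM x = nbM y /\ trace_eq (labels (repr x)) (labels (repr y)).

Lemma modelM_of_word u v :
  modelM (@of_word (Gplus n) u) (@of_word (Gplus n) v) <-> model_eq u v.
Proof.
have [Eu tu] := model_eq_repr u; have [Ev tv] := model_eq_repr v.
rewrite /modelM /model_eq !nbM_of_word; split=> -[E t]; split=> // i j nij.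
  by rewrite -tu // -tv // t.
by rewrite tu // tv // t.
Qed.

Lemma modelM_mul2l z x y : modelM (z * x) (z * y) -> modelM x y.
Proof.
rewrite -(of_word_repr x) -(of_word_repr y) -(of_word_repr z) -!of_wordM.
rewrite !modelM_of_word /model_eq !nb_cat !labels_cat => -[/addnI Enb]; split=> //.
exact/trace_eq_shiftn/(trace_eq_catl b).
Qed.

Lemma modelM_front x y : modelM x y -> frontM^~ x =1 frontM^~ y.
Proof. by move=> [_ t] j; apply: front_trace_eq. Qed.

(* Faithfulness: a front letter a or c of either side splits off both sides by
   [front_shapeP]; otherwise both sides start with b. *)
Lemma modelM_eq x y : modelM x y -> x = y.
Proof.
have [k] := ubnP (deg x + deg y); elim: k x y => // k IHk x y /ltnSE dxy xy.
have Efront := modelM_front xy.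
have step x' y' z : x = z * x' -> y = z * y' -> (0 < deg z)%N -> x = y.
  move=> Ex Ey z0; rewrite Ex Ey; congr (_ * _); apply: IHk.
    by move: dxy; rewrite Ex Ey !degM; lia.
  by apply: (@modelM_mul2l z); rewrite -Ex -Ey.
have dega : (0 < deg ma)%N by rewrite deg_of_word.
have degb : (0 < deg mb)%N by rewrite deg_of_word.
have degc : (0 < deg mc)%N by rewrite deg_of_word.
have caseA x' : x = ma * x' -> x = y.
  move=> Ex; have /front1P[y' Ey] : frontM l1 y by rewrite -Efront Ex frontM_a eqxx.
  exact: step Ex Ey dega.
have caseA' y' : y = ma * y' -> x = y.
  move=> Ey; have /front1P[x' Ex] : frontM l1 x by rewrite Efront Ey frontM_a eqxx.
  exact: step Ex Ey dega.
have caseC x' : x = mc * x' -> x = y.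
  move=> Ex; have /front0P[y' Ey] : frontM l0 y by rewrite -Efront Ex frontM_c eqxx.
  exact: step Ex Ey degc.
have caseC' y' : y = mc * y' -> x = y.
  move=> Ey; have /front0P[x' Ex] : frontM l0 x by rewrite Efront Ey frontM_c eqxx.
  exact: step Ex Ey degc.
have nbb z : nbM (mb * z) = (nbM z).+1 by rewrite nbMM nbM_of_word.
have nb1 : nbM 1 = 0%N by rewrite nbM_of_word.
have [Enb _] := xy.
have [x1|[x' Ex]|[x' Ex]|[x' Ex]] := presentedP x; [|exact: caseA Ex| |exact: caseC Ex].
  have [y1|[y' Ey]|[y' Ey]|[y' Ey]] := presentedP y; [|exact: caseA' Ey| |exact: caseC' Ey].
    by rewrite x1 y1.
  by move: Enb; rewrite x1 Ey nb1 nbb.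
have [y1|[y' Ey]|[y' Ey]|[y' Ey]] := presentedP y; [|exact: caseA' Ey| |exact: caseC' Ey].
  by move: Enb; rewrite y1 Ex nb1 nbb.
exact: step Ex Ey degb.
Qed.

Lemma modelM_refl x : modelM x x.
Proof. by split. Qed.

(** Left cancellation holds in the model and passes to the monoid by faithfulness. *)
Lemma mulM_inj z : injective (fun x => z * x).
Proof.
by move=> x y E; apply/modelM_eq/(@modelM_mul2l z); rewrite E; exact: modelM_refl.
Qed.

(** * Divisibility and minimal common multiples *)

(** On a cycle of length n + 1, n steps forward are one step back. *)
Lemma iter_ordS_l1 : iter n (@ordS _) (ordS l1) = l1.
Proof.
rewrite /l1 -!iterSr !iterS; congr ordS; apply: ord_inj.
by rewrite val_ordS iter_ordS // add0n eqxx.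
Qed.

Lemma frontM_bX k (j : 'I_n.+1) x : frontM (iter k (@ordS _) j) (mb ^+ k * x) = frontM j x.
Proof.
elim: k => [|k IHk]; first by rewrite mul1g.
by rewrite iterS expgS -mulgA frontM_b.
Qed.

(** b^(n+1) is a full turn of the cycle, so it fixes every label. *)
Lemma mulbnba : commute (mb ^+ n * mb) ma.
Proof.
by rewrite /commute -expgSr expgS -mulgA -mulcbn !mulgA mulab.
Qed.

(** Label 1 is in front of the right-hand side, hence label 2 in front of x, and x = b a z. As
    b^(n+1) commutes with a, one a cancels, leaving the same equation for b z with exponent k. *)
Lemma divides_bn k x y : mb ^+ n * x = ma ^+ k.+1 * mb ^+ n * y ->
  exists z, x = mb * ma ^+ k.+1 * z.
Proof.
elim: k x => [|k IHk] x E.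
  apply: front2P; rewrite -(frontM_bX n) iter_ordS_l1 E.
  by rewrite expg1 -mulgA frontM_a eqxx.
have [z Ez] : exists z, x = mb * ma * z.
  apply: front2P; rewrite -(frontM_bX n) iter_ordS_l1 E.
  by rewrite expgS -!mulgA frontM_a eqxx.
have [|z' Ez'] := IHk (mb * z).
  apply: (@mulM_inj ma); move: E; rewrite Ez (expgS ma) !mulgA => <-.
  by rewrite -(mulgA ma) -mulbnba -!mulgA.
exists z'; rewrite Ez expgS -!mulgA; congr (_ * (_ * _)).
by apply: (@mulM_inj mb); rewrite /= Ez' !mulgA.
Qed.

(** The elements u_i. Despite the name they are pairwise incomparable for divisibility, see
    [chain_antichain]. *)
Definition chain i : M := ma ^+ i * mc * mb ^+ n.

Lemma degX x k : deg (x ^+ k) = (k * deg x)%N.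
Proof.
elim: k => [|k IHk]; first by rewrite expg0 deg1.
by rewrite expgS degM IHk mulSn.
Qed.

Lemma deg_chain i : deg (chain i) = (n + 1 + i)%N.
Proof. by rewrite /chain !degM !degX !deg_of_word /=; lia. Qed.

Lemma chainD i k : chain (i + k) = ma ^+ i * mc * (ma ^+ k * mb ^+ n).
Proof.
rewrite /chain expgnDr -!mulgA; congr (_ * _); rewrite !mulgA; congr (_ * _).
by rewrite -[mc]expg1 mulacX.
Qed.

Lemma ldvd_trans x y z : ldvd x y -> ldvd y z -> ldvd x z.
Proof. by move=> [s ->] [t ->]; exists (s * t); rewrite mulgA. Qed.

Lemma ldvd_mulr x y : ldvd x (x * y).
Proof. by exists y. Qed.

Lemma ldvd_refl x : ldvd x x.
Proof. by exists 1; rewrite mulg1. Qed.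

(** Cancelling the common prefix a^i c leaves an equation b^n y = a^(k-i) b^n z for [divides_bn],
    and u_i b a^(k-i) = u_k b. With [chain_ldvd_mulb], the least common multiple of u_i and u_k
    depends only on the larger index. *)
Lemma chain_ldvd i k x : (i < k)%N ->
  ldvd (chain i) x -> ldvd (chain k) x -> ldvd (chain k * mb) x.
Proof.
move=> ik [y Ey] [z Ez].
have Ek : k = (i + (k - i).-1.+1)%N by lia.
move: (k - i).-1 Ek => m Ek; rewrite {}Ek {k ik} in Ez *.
have [t Et] : exists t, y = mb * ma ^+ m.+1 * t.
  apply: (@divides_bn _ _ z); apply: (@mulM_inj (ma ^+ i * mc)).
  by rewrite /= mulgA -/(chain i) -Ey Ez chainD !mulgA.
exists t; rewrite Ey Et chainD /chain !mulgA; congr (_ * _).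
by rewrite -(mulgA _ _ mb) -(mulgA _ (mb ^+ n * mb)) (commuteX m.+1 mulbnba) !mulgA.
Qed.

Lemma chain_ldvd_mulb i k : (i <= k)%N -> ldvd (chain i) (chain k * mb).
Proof.
move=> ik; rewrite -(subnKC ik) chainD; exists (mb * ma ^+ (k - i)).
rewrite /chain !mulgA -[in RHS](mulgA _ (mb ^+ n) mb) -[in RHS](mulgA _ (mb ^+ n * mb)).
by rewrite (commuteX _ mulbnba) !mulgA.
Qed.

(** If i < k, u_k would be a common multiple of both, hence divisible by u_k b, which has larger
    degree. *)
Lemma chain_antichain i k : ldvd (chain i) (chain k) -> i = k.
Proof.
move=> ik; have := ldvd_deg ik; rewrite !deg_chain leq_add2l leq_eqVlt.
case/orP=> [/eqP //|lt_ik].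
have /ldvd_deg := chain_ldvd lt_ik ik (ldvd_refl _).
by rewrite degM deg_chain (@deg_of_word (Gplus n) [:: gb]) /=; lia.
Qed.

Lemma chain_inj : injective chain.
Proof. by move=> i k E; apply: chain_antichain; rewrite E; exact: ldvd_refl. Qed.

Lemma ldvd_ma x : ldvd ma x -> frontM l1 x.
Proof. by case=> y ->; rewrite frontM_a eqxx. Qed.

Lemma ldvd_mc x : ldvd mc x -> frontM l0 x.
Proof. by case=> y ->; rewrite frontM_c eqxx. Qed.

Lemma ldvd_mac x : ldvd ma x -> ldvd mc x -> ldvd (ma * mc) x.
Proof.
case=> y ->; move/ldvd_mc; rewrite frontM_a => /orP[/eqP|/andP[_ /front0P[z ->]]].
  by move/(congr1 (@nat_of_ord _)); rewrite val_l1.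
by exists z; rewrite mulgA.
Qed.

Lemma ldvd_mab x : ldvd ma x -> ldvd mb x -> ldvd (ma * mb) x.
Proof.
move=> /ldvd_ma ax [y Ey]; move: ax; rewrite Ey frontM_b => /front0P[z ->].
by exists z; rewrite mulab mulgA.
Qed.

Lemma ordS_max : ordS ord_max = l0.
Proof. by apply: ord_inj; rewrite val_ordS eqxx. Qed.

(** Label 0 in front of b y is label n in front of y, so y starts with some c^i b^(n-1) a; and b c^i
    b^(n-1) a = a^i b^n a = u_i. *)
Lemma ldvd_mbc x : ldvd mb x -> ldvd mc x -> exists i, ldvd (chain i) x.
Proof.
case=> y -> /ldvd_mc; rewrite -ordS_max frontM_b => /frontnP[i [z ->]].
exists i, z; rewrite !mulgA -mulaXb -(mulgA _ mb) -expgS (prednK n_gt0).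
by rewrite /chain -!mulgA (mulgA mc) mulcbn !mulgA.
Qed.

Lemma ma_chain i : ldvd ma (chain i.+1).
Proof. by rewrite /chain expgS -!mulgA; exact: ldvd_mulr. Qed.

Lemma mc_chain i : ldvd mc (chain i).
Proof. by rewrite /chain -[mc]expg1 mulacX expg1 -!mulgA; exact: ldvd_mulr. Qed.

Lemma mb_chain i : ldvd mb (chain i).
Proof.
have Ebn : mb ^+ n = mb * mb ^+ n.-1 by rewrite -expgS prednK.
rewrite /chain -!mulgA mulcbn Ebn !mulgA mulaXb.
by rewrite -!mulgA; exact: ldvd_mulr.
Qed.

(** Only u_0 y needs an argument. Divisibility by a puts label 1 in front of b^n y, hence label 2 in
    front of y, so y = b a z and u_0 b a z = u_1 b z. *)
Lemma ldvd_mabc x : ldvd ma x -> ldvd mb x -> ldvd mc x ->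
  exists i, ldvd (chain i.+1) x.
Proof.
move=> ax bx cx; have [[|i] ix] := ldvd_mbc bx cx; last by exists i.
exists 0%N; case: ix => y Ey; move: ax => /ldvd_ma; rewrite Ey.
rewrite /chain mul1g -mulgA frontM_c => /orP[/eqP/(congr1 (@nat_of_ord _))|].
  by rewrite val_l1.
case/andP=> _; rewrite -{1}iter_ordS_l1 frontM_bX => /front2P[z ->].
exists (mb * z); rewrite expg1 !mulgA -(mulgA mc) -(mulgA mc) mulbnba.
by rewrite !mulgA mulac.
Qed.

Local Open Scope classical_set_scope.

Lemma mcm_antichain (J F : set M) :
  F `<=` cm_r J ->
  (forall x, cm_r J x -> exists2 y, F y & ldvd y x) ->
  (forall x y, F x -> F y -> ldvd x y -> x = y) ->
  mcm J = F.
Proof.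
move=> FJ JF antiF; apply/seteqP; split=> x.
  by case=> /[dup] xJ /JF[y Fy yx] minx; rewrite -(minx y (FJ _ Fy) yx).
move=> Fx; split; first exact: FJ.
move=> y /JF[z Fz zy] yx; have zx := antiF _ _ Fz Fx (ldvd_trans zy yx).
by apply: ldvd_deg_eq yx _; rewrite -zx; exact: ldvd_deg.
Qed.

Lemma mcm_unique (J : set M) x :
  cm_r J x -> (forall y, cm_r J y -> ldvd x y) -> mcm J = [set x].
Proof.
move=> Jx minx; apply: mcm_antichain => [y ->//|y /minx xy|y z -> ->//].
by exists x.
Qed.

Lemma mcm_ab : mcm [set` [fset ma; mb]%fset] = [set ma * mb].
Proof.
apply: mcm_unique => [x|x xJ].
  rewrite /= !inE => /orP[]/eqP->; first exact: ldvd_mulr.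
  by rewrite mulab; exact: ldvd_mulr.
by apply: ldvd_mab; apply: xJ; rewrite /= !inE eqxx ?orbT.
Qed.

Lemma mcm_ac : mcm [set` [fset ma; mc]%fset] = [set ma * mc].
Proof.
apply: mcm_unique => [x|x xJ].
  rewrite /= !inE => /orP[]/eqP->; first exact: ldvd_mulr.
  by rewrite mulac; exact: ldvd_mulr.
by apply: ldvd_mac; apply: xJ; rewrite /= !inE eqxx ?orbT.
Qed.

Lemma mcm_bc : mcm [set` [fset mb; mc]%fset] = range chain.
Proof.
apply: mcm_antichain => [_ [i _ <-] x|x xJ|_ _ [i _ <-] [k _ <-] /chain_antichain-> //].
  by rewrite /= !inE => /orP[]/eqP->; [exact: mb_chain|exact: mc_chain].
have [||i ix] := @ldvd_mbc x; try by apply: xJ; rewrite /= !inE eqxx ?orbT.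
by exists (chain i) => //; exists i.
Qed.

Lemma mcm_abc : mcm [set` [fset ma; mb; mc]%fset] = range (fun i => chain i.+1).
Proof.
apply: mcm_antichain => [_ [i _ <-] x|x xJ|_ _ [i _ <-] [k _ <-] /chain_antichain[-> //]].
  rewrite /= !inE => /orP[/orP[]|]/eqP->; last exact: mc_chain.
    exact: ma_chain.
  exact: mb_chain.
have [|||i ix] := @ldvd_mabc x; try by apply: xJ; rewrite /= !inE eqxx ?orbT.
by exists (chain i.+1) => //; exists i.
Qed.

(** u_k and any one other member already force the factor u_k b, which all the lower u_i divide. *)
Lemma mcm_chain (J : {fset M}) k :
  (1 < #|` J|)%N -> [set` J] `<=` [set chain i | i in [set i | (i <= k)%N]] ->
  chain k \in J -> mcm [set` J] = [set chain k * mb].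
Proof.
move=> J1 Jk kJ; apply: mcm_unique => [x /Jk[i /= ik <-]|x xJ].
  exact: chain_ldvd_mulb.
have [y yJ yk] : exists2 y, y \in J & y != chain k.
  apply: contrapT => ny; move: J1; rewrite ltnNge => /negP; apply.
  rewrite -(cardfs1 (chain k)); apply/fsubset_leq_card/fsubsetP => v vJ.
  by rewrite inE; apply/negP => /negP vk; apply: ny; exists v.
have [i /= ik Ei] := Jk _ yJ.
apply: (@chain_ldvd i); last exact: xJ.
  by rewrite ltn_neqAle ik andbT; apply: contra_neq yk => <-.
by apply: xJ; rewrite Ei.
Qed.

(** * Towers *)

Definition Jab := [fset ma; mb]%fset.
Definition Jac := [fset ma; mc]%fset.
Definition Jbc := [fset mb; mc]%fset.
Definition Jabc := [fset ma; mb; mc]%fset.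

Lemma ma_neq_mb : ma != mb.
Proof. by apply/eqP => /(congr1 nbM); rewrite !nbM_of_word. Qed.

Lemma mc_neq_mb : mc != mb.
Proof. by apply/eqP => /(congr1 nbM); rewrite !nbM_of_word. Qed.

(** Counting b's cannot separate a from c; their front labels do. *)
Lemma ma_neq_mc : ma != mc.
Proof.
apply/eqP => /(congr1 (frontM l1)); rewrite -(mulg1 ma) -(mulg1 mc).
rewrite frontM_a frontM_c !frontM1 eqxx !andbF !orbF => /esym /eqP.
by move/(congr1 (@nat_of_ord _)); rewrite val_l1.
Qed.

Lemma generatorsE : generators (P := Gplus n) = [set` [fset ma; mb; mc]%fset].
Proof.
apply/seteqP; split=> x.
  case=> -[[|[|[|//]]] l3] _ <-; rewrite /= !inE.
  - by rewrite (_ : Ordinal l3 = ga) ?eqxx //; exact: val_inj.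
  - by rewrite (_ : Ordinal l3 = gb) ?eqxx ?orbT //; exact: val_inj.
  - by rewrite (_ : Ordinal l3 = gc) ?eqxx ?orbT //; exact: val_inj.
by rewrite /= !inE => /orP[/orP[]|]/eqP->; [exists ga|exists gb|exists gc].
Qed.

Lemma fset_card_gt1 (J : {fset M}) x : (1 < #|` J|)%N -> ~ [set` J] `<=` [set x].
Proof.
move=> J1 Jx; move: J1; rewrite ltnNge -(cardfs1 x) => /negP; apply.
by apply/fsubset_leq_card/fsubsetP => y /Jx /= ->; rewrite inE.
Qed.

Lemma generatorsP x : generators (P := Gplus n) x -> [\/ x = ma, x = mb | x = mc].
Proof.
rewrite generatorsE /= !inE -orbA => /or3P[]/eqP->;
  by [constructor 1|constructor 2|constructor 3].
Qed.

Lemma sub_generators (J : {fset M}) :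
  [set` J] `<=` generators (P := Gplus n) -> (1 < #|` J|)%N ->
  J \in [:: Jab; Jac; Jbc; Jabc].
Proof.
move=> JG J1.
have JE (K : {fset M}) : (K `<=` Jabc)%fset -> (ma \in J) = (ma \in K) ->
    (mb \in J) = (mb \in K) -> (mc \in J) = (mc \in K) -> J = K.
  move=> /fsubsetP KG Ea Eb Ec; apply/fsetP => x.
  apply/idP/idP=> [/[dup] /JG/generatorsP[]->|/[dup] /KG]; rewrite ?Ea ?Eb ?Ec //.
  by rewrite !inE -orbA => /or3P[]/eqP->; rewrite ?Ea ?Eb ?Ec.
(* Disposes of the four subsets with at most one element. *)
have small x : (ma \in J) ==> (ma == x) -> (mb \in J) ==> (mb == x) ->
    (mc \in J) ==> (mc == x) -> False.
  move=> /implyP a /implyP b /implyP c; apply: (fset_card_gt1 (x := x) J1) => y.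
  by move=> /[dup] /JG/generatorsP[]-> => [/a|/b|/c] /eqP.
have ab := negPf ma_neq_mb; have cb := negPf mc_neq_mb; have ac := negPf ma_neq_mc.
have ba := ab; have bc := cb; have ca := ac; rewrite eq_sym in ba.
rewrite eq_sym in bc; rewrite eq_sym in ca.
pose eqs := (ab, cb, ac, ba, bc, ca).
have sub1 : (Jab `<=` Jabc)%fset by apply/fsubsetP => x; rewrite !inE => ->.
have sub2 : (Jac `<=` Jabc)%fset.
  by apply/fsubsetP => x; rewrite !inE => /orP[]->; rewrite ?orbT.
have sub3 : (Jbc `<=` Jabc)%fset.
  by apply/fsubsetP => x; rewrite !inE => /orP[]->; rewrite ?orbT.
case aJ: (ma \in J); case bJ: (mb \in J); case cJ: (mc \in J).
- by rewrite (JE Jabc) ?aJ ?bJ ?cJ ?inE ?eqs ?eqxx ?orbT.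
- by rewrite (JE Jab) ?aJ ?bJ ?cJ // ?inE ?eqs ?eqxx ?orbT.
- by rewrite (JE Jac) ?aJ ?bJ ?cJ // ?inE ?eqs ?eqxx ?orbT.
- by case: (small ma); rewrite ?aJ ?bJ ?cJ ?eqxx.
- by rewrite (JE Jbc) ?aJ ?bJ ?cJ // ?inE ?eqs ?eqxx ?orbT.
- by case: (small mb); rewrite ?aJ ?bJ ?cJ ?eqxx.
- by case: (small mc); rewrite ?aJ ?bJ ?cJ ?eqxx.
- by case: (small ma); rewrite ?aJ ?bJ ?cJ.
Qed.

(** * Counting elements by degree, and finite subsets of the chain *)

Definition deg_count (d : nat) (A : set M) : int :=
  (\sum_(D \in A) ((deg D == d)%:R : int))%R.

Lemma deg_count0 d (A : set M) : (forall D, A D -> deg D != d) -> deg_count d A = 0%R.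
Proof. by move=> Ad; apply: fsbig1 => D /Ad/negPf->. Qed.

Lemma deg_count1 d (A : set M) D0 : A D0 -> deg D0 = d ->
  (forall D, A D -> deg D = d -> D = D0) -> deg_count d A = 1%R.
Proof.
move=> AD0 dD0 uniD; rewrite /deg_count -(@fsbig_widen _ _ _ _ [set D0]).
- by rewrite fsbig_set1 dD0 eqxx.
- by move=> D ->.
- move=> D [AD DD0] /=; case: eqP => // dD.
  by case: DD0; rewrite /= (uniD D).
Qed.

Lemma deg_count_set1 d x : deg_count d [set x] = (deg x == d)%:R%R.
Proof. exact: fsbig_set1. Qed.

Lemma deg_count_chain d k :
  deg_count d (range (fun i => chain (i + k))) = (n + 1 + k <= d)%N%:R%R.
Proof.
case: leqP => ld.
  apply: (@deg_count1 _ _ (chain (d - (n + 1 + k) + k))); first by exists (d - (n + 1 + k))%N.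
    by rewrite deg_chain; lia.
  by move=> _ [i _ <-]; rewrite deg_chain => <-; congr chain; lia.
apply: deg_count0 => _ [i _ <-]; rewrite deg_chain; lia.
Qed.

Lemma deg_count_generators d : deg_count d (generators (P := Gplus n)) = ((d == 1%N)%:R *+ 3)%R.
Proof.
have uniq3 : uniq [:: ma; mb; mc].
  by rewrite /= !inE negb_or ma_neq_mb ma_neq_mc eq_sym mc_neq_mb.
rewrite /deg_count (_ : generators (P := Gplus n) = [set` [:: ma; mb; mc]]); last first.
  by rewrite generatorsE; apply/seteqP; split=> x /=; rewrite !inE -orbA.
rewrite -fsbig_seq // !big_cons big_nil !deg_of_word /= eq_sym.
by rewrite addr0 -!mulr2n -mulrS.
Qed.

Lemma tower1 (J : {fset M}) : [set` J] `<=` generators (P := Gplus n) ->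
  (1 < #|` J|)%N -> mcm [set` J] !=set0 -> Tmcm [:: J].
Proof. by move=> JG J1 mJ [|//]. Qed.

Lemma tower2 (J K : {fset M}) : Tmcm [:: J] -> [set` K] `<=` mcm [set` J] ->
  (1 < #|` K|)%N -> mcm [set` K] !=set0 -> Tmcm [:: J; K].
Proof. by move=> towJ KJ K1 mK [|[|//]] // _; exact: (towJ 0%N isT). Qed.

(** The degree bounds the index, so a finite set of u_i has a largest index. *)
Lemma chain_fset (K : {fset M}) :
  [set` K] `<=` range chain -> (1 < #|` K|)%N ->
  exists2 k, chain k \in K &
             [set` K] `<=` [set chain i | i in [set i | (i <= k)%N]].
Proof.
move=> Kc K1.
have exk : exists k, chain k \in K.
  have [x xK] : exists x, x \in K by apply/fset0Pn; rewrite -cardfs_gt0 ltnW.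
  by have [k _ Ek] := Kc _ xK; exists k; rewrite Ek.
have bnd k : chain k \in K -> (k <= \max_(x <- K) deg x)%N.
  move=> kK; apply: leq_trans (leq_bigmax_seq _ kK isT).
  by rewrite deg_chain; lia.
case: (ex_maxnP exk bnd) => k kK maxk; exists k => // x xK.
by have [i _ Ei] := Kc _ xK; exists i => //=; apply: maxk; rewrite Ei.
Qed.

(** A set with largest index m is encoded by the set B of its smaller indices, so that signed sums
    over such sets become sums over subsets of ['I_m]. *)
Definition chain_set m (B : {set 'I_m}) : {fset M} :=
  (chain m |` [fset chain (val i) | i in B])%fset.

Lemma chain_setP m (B : {set 'I_m}) k :
  (chain k \in chain_set B) = (k == m) || [exists i in B, val i == k].
Proof.
rewrite !inE (inj_eq chain_inj); congr (_ || _).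
apply/imfsetP/existsP => [[i /= iS /chain_inj ->]|[i /andP[iS /eqP <-]]].
  by exists i; rewrite iS /=.
by exists i.
Qed.

Lemma chain_set_range m (B : {set 'I_m}) :
  [set` chain_set B] `<=` [set chain i | i in [set i | (i <= m)%N]].
Proof.
move=> x; rewrite /= !inE => /orP[/eqP->|/imfsetP[i _ ->]].
  by exists m => //=.
by exists (val i) => //=; exact/ltnW.
Qed.

Lemma card_chain_set m (B : {set 'I_m}) : #|` chain_set B| = #|B|.+1.
Proof.
have cinj : injective (fun i : 'I_m => chain (val i)).
  by move=> i j /chain_inj/val_inj.
rewrite cardfsU1 card_imfset //= -cardE; case: imfsetP => [[i _ /chain_inj E]|_] //.
by have := ltn_ord i; move: E => /=; lia.
Qed.

Lemma chain_set_inj m : injective (@chain_set m).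
Proof.
move=> B U E; apply/setP => i; have := congr1 (fun K => chain (val i) \in K) E.
rewrite !chain_setP (ltn_eqF (ltn_ord i)) /=.
have H (W : {set 'I_m}) : [exists j in W, val j == val i] = (i \in W).
  apply/existsP/idP => [[j /andP[jW /eqP/val_inj <-]] //|iW].
  by exists i; rewrite iW /=.
by rewrite !H.
Qed.

(** * The towers reaching a given degree, and their signed sum *)

Section Degree.
Variable d : nat.

(* A tower J_1, J_2 has top {chain k b} with k the largest index in J_2; in degree
   d this forces k = d - (n + 2). If d < n + 2 the subtraction gives m = 0 and
   there are no nonempty subsets of 'I_m, as it should be. *)
Let m := (d - (n + 2))%N.

(** Nonemptiness of B expresses that J_2 has more than one element. *)
Definition nonempty_subsets (A : {set 'I_m}) : seq {set 'I_m} :=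
  enum [pred B : {set 'I_m} | (B \subset A) && (B != finset.set0)].

Definition chain_towers (J : {fset M}) (A : {set 'I_m}) : seq (seq {fset M}) :=
  [seq [:: J; chain_set B] | B <- nonempty_subsets A].

Definition positives : {set 'I_m} := finset (fun i : 'I_m => 0 < i)%N.

(** Contains every tower whose top meets degree d; the five of height at most 1 are listed for every
    d, even when they contribute 0. *)
Definition towers : seq (seq {fset M}) :=
  [:: [::]; [:: Jab]; [:: Jac]; [:: Jbc]; [:: Jabc]] ++
  chain_towers Jbc finset.setT ++ chain_towers Jabc positives.

Lemma mcm_chain_set (B : {set 'I_m}) : B != finset.set0 ->
  mcm [set` chain_set B] = [set chain m * mb].
Proof.
move=> S0; apply: mcm_chain; first by rewrite card_chain_set ltnS card_gt0.
  exact: chain_set_range.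
by rewrite !inE eqxx.
Qed.

Lemma cardJabc : #|` Jabc| = 3.
Proof.
rewrite /Jabc fsetUC cardfsU1 cardfs2 ma_neq_mb !inE.
by rewrite negb_or eq_sym ma_neq_mc mc_neq_mb.
Qed.

Lemma height1_tower J : [:: J] \in [:: [:: Jab]; [:: Jac]; [:: Jbc]; [:: Jabc]] ->
  Tmcm [:: J].
Proof.
move=> JT; apply: tower1.
- move: JT; rewrite generatorsE !inE => /or4P[]/eqP[->] x /=; rewrite !inE //.
  + by move=> ->.
  + by move=> /orP[]->; rewrite ?orbT.
  + by move=> /orP[]->; rewrite ?orbT.
- move: JT; rewrite !inE => /or4P[]/eqP[->].
  + by rewrite cardfs2 ma_neq_mb.
  + by rewrite cardfs2 ma_neq_mc.
  + by rewrite cardfs2 eq_sym mc_neq_mb.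
  + by rewrite cardJabc.
- move: JT; rewrite !inE => /or4P[]/eqP[->].
  + by rewrite mcm_ab; eexists.
  + by rewrite mcm_ac; eexists.
  + by rewrite mcm_bc; exists (chain 0), 0%N.
  + by rewrite mcm_abc; exists (chain 1), 0%N.
Qed.

Lemma chain_tower (J : {fset M}) (A : {set 'I_m}) T : Tmcm [:: J] ->
  (forall i : 'I_m, i \in A -> mcm [set` J] (chain i)) ->
  ((0 < m)%N -> mcm [set` J] (chain m)) ->
  T \in chain_towers J A -> Tmcm T.
Proof.
move=> towJ JA Jm /mapP[B]; rewrite mem_enum inE => /andP[SA S0] ->.
apply: tower2 => //.
- move=> x /=; rewrite !inE => /orP[/eqP->|/imfsetP[i iS ->]].
    by apply: Jm; have /finset.set0Pn[[i im] _] := S0; exact: leq_ltn_trans im.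
  exact/JA/(fintype.subsetP SA).
- by rewrite card_chain_set ltnS card_gt0.
- by rewrite mcm_chain_set //; eexists.
Qed.

Lemma towers_Tmcm : [set` towers] `<=` @Tmcm (Gplus n).
Proof.
move=> T; rewrite /= mem_cat => /orP[|]; last rewrite mem_cat => /orP[].
- rewrite in_cons => /orP[/eqP -> k //|TJ].
  case: T TJ => [//|J [|K T]]; first exact: height1_tower.
  by rewrite !inE /= !eqseq_cons !andbF.
- apply: chain_tower => [|i _|_]; last 2 first.
  + by rewrite mcm_bc; exists i.
  + by rewrite mcm_bc; exists m.
  by apply: height1_tower; rewrite !inE eqxx ?orbT.
- apply: chain_tower => [|i|m0]; last 2 first.
  + by rewrite inE mcm_abc => i0; exists (i.-1) => //; rewrite prednK.
  + by rewrite mcm_abc; exists m.-1 => //; rewrite prednK.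
  by apply: height1_tower; rewrite !inE eqxx ?orbT.
Qed.

Lemma Jbc_neq_Jabc : Jbc != Jabc.
Proof.
apply/eqP => /(congr1 (fun K => #|` K|)); rewrite cardJabc cardfs2.
by case: (_ != _).
Qed.

Lemma chain_towersP (J : {fset M}) (A : {set 'I_m}) T : T \in chain_towers J A ->
  exists B : {set 'I_m}, [/\ B \subset A, B != finset.set0 & T = [:: J; chain_set B]].
Proof.
by case/mapP => B; rewrite mem_enum inE => /andP[BA B0] ->; exists B.
Qed.

Lemma chain_towers_uniq (J : {fset M}) (A : {set 'I_m}) : uniq (chain_towers J A).
Proof.
by rewrite map_inj_uniq ?enum_uniq // => B U [/chain_set_inj].
Qed.

Lemma towers_uniq : uniq towers.
Proof.
rewrite /towers !cat_uniq !chain_towers_uniq andbT andTb.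
apply/andP; split; last (apply/andP; split; last (apply/hasPn => T)).
(* A fingerprint separating the five towers of height at most 1. *)
- pose f (T : seq {fset M}) := (size T, ma \in head fset0 T, mb \in head fset0 T,
                                mc \in head fset0 T).
  have ab := negPf ma_neq_mb; have cb := negPf mc_neq_mb; have ac := negPf ma_neq_mc.
  have ba := ab; have bc := cb; have ca := ac; rewrite eq_sym in ba.
  rewrite eq_sym in bc; rewrite eq_sym in ca.
  apply: (@map_uniq _ _ f); rewrite /f /= !inE !eqxx ?orbT.
  by rewrite ab cb ac ba bc ca.
- apply/hasPn => T; rewrite mem_cat => /orP[] /chain_towersP[B [_ _ ->]];
    by rewrite !inE /= !eqseq_cons !andbF.
- case/chain_towersP => B [_ _ ->]; apply/negP => /chain_towersP[U [_ _ [E _]]].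
  by have := Jbc_neq_Jabc; rewrite E eqxx.
Qed.

Lemma chain_towers_complete (J K : {fset M}) (A : {set 'I_m}) T :
  mcm [set` J] `<=` range chain ->
  (forall i : 'I_m, mcm [set` J] (chain i) -> i \in A) ->
  Tmcm [:: J, K & T] ->
  (exists2 D, tower_top [:: J, K & T] D & deg D = d) ->
  [:: J, K & T] \in chain_towers J A.
Proof.
move=> Jc JA towT [D topD degD].
have [/= KJ K1 _] := towT 1%N isT.
have [k kK Kk] : exists2 k, chain k \in K &
             [set` K] `<=` [set chain i | i in [set i | (i <= k)%N]].
  by apply: chain_fset => // x /KJ/Jc.
have mK := mcm_chain K1 Kk kK.
(* A third level would need two elements inside the singleton {u_k b}. *)
case: T towT topD => [|L T] towT topD; last first.
  have [/= LK L1 _] := towT 2%N isT.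
  by case: (@fset_card_gt1 L (chain k * mb) L1); rewrite -mK.
(* The top u_k b has degree n + 2 + k, which must equal d. *)
have Ek : k = m.
  move: topD; rewrite /tower_top /= mK => /= ED; move: degD.
  by rewrite ED degM deg_chain (@deg_of_word (Gplus n) [:: gb]) /= /m; lia.
rewrite {}Ek {k} in kK Kk mK.
pose B : {set 'I_m} := finset (fun i : 'I_m => chain i \in K).
have BK : K = chain_set B.
  apply/fsetP => x; rewrite !inE; apply/idP/orP => [xK|[/eqP->//|/imfsetP[i /=]]].
    have [i /=] := Kk _ xK; rewrite leq_eqVlt => /orP[/eqP->|im] Ei; [left|right].
      by rewrite Ei.
    apply/imfsetP; exists (Ordinal im) => //=.
    by rewrite inE /= Ei.
  by rewrite inE => iK ->.
apply/mapP; exists B; last by rewrite BK.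
rewrite mem_enum inE; apply/andP; split.
  by apply/fintype.subsetP => i; rewrite inE => iK; exact/JA/KJ.
by rewrite -card_gt0 -ltnS -card_chain_set -BK.
Qed.

Lemma towers_complete T : Tmcm T -> (exists2 D, tower_top T D & deg D = d) ->
  T \in towers.
Proof.
move=> towT topT; rewrite /towers !mem_cat.
case: T towT topT => [//|J T] towT topT.
have [/= JG J1 _] := towT 0%N isT.
have := sub_generators JG J1.
case: T towT topT => [|K T] towT topT.
  by rewrite !inE => /or4P[]/eqP->; rewrite eqxx ?orbT.
have [/= KJ K1 _] := towT 1%N isT.
rewrite !(in_cons _ _ J) in_nil orbF => /or4P[]/eqP EJ; subst J.
- by case: (@fset_card_gt1 K (ma * mb) K1); rewrite -mcm_ab.
- by case: (@fset_card_gt1 K (ma * mc) K1); rewrite -mcm_ac.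
- apply/orP; right; apply/orP; left.
  by apply: chain_towers_complete => // [x|i _]; [rewrite mcm_bc|rewrite inE].
- apply/orP; right; apply/orP; right.
  apply: chain_towers_complete => // [x|i]; rewrite mcm_abc.
    by case=> i _ <-; exists i.+1.
  by case=> k _ /chain_inj E; rewrite inE -E.
Qed.

Definition term (T : seq {fset M}) : int :=
  (tower_sign T * deg_count d (tower_top T))%R.

Lemma skew_growth_towers :
  skew_growth (Gplus n) d = ((d == 0%N)%:R + \sum_(T <- towers) term T)%R.
Proof.
rewrite /skew_growth; congr (_ + _)%R.
rewrite (fsbigE _ _ towers_uniq towers_Tmcm); last first.
  move=> T towT TT; rewrite -/(deg_count d (tower_top T)) deg_count0 ?mulr0 // => D topD.
  by apply: contraNneq TT => dD; apply: towers_complete => //; exists D.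
rewrite big_seq_cond [RHS]big_seq; apply: eq_bigl => T.
rewrite andbC; case: (boolP (T \in towers)) => TT; rewrite ?andbF // andbT.
exact/mem_set/towers_Tmcm.
Qed.

Lemma term_chain_towers (J : {fset M}) (A : {set 'I_m}) : (1 < #|` J|)%N ->
  (\sum_(T <- chain_towers J A) term T =
   (-1) ^+ #|` J| * ((A == finset.set0)%:R - 1))%R.
Proof.
move=> J1; rewrite big_map big_enum -sum_sign_nonempty_subsets mulr_sumr /=.
apply: eq_bigr => B /andP[_ B0].
rewrite /term /tower_top /= mcm_chain_set // deg_count_set1.
(* An element of B gives 0 < m, so the subtraction in [m] is exact and the top has degree d. *)
have [i _] := finset.set0Pn _ B0; have := ltn_ord i; rewrite {2}/m => im.
rewrite degM deg_chain (@deg_of_word (Gplus n) [:: gb]) /=.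
have -> : (n + 1 + m + 1 == d)%N by rewrite /m; lia.
(* The exponent of the sign is #J + (#B + 1) - 2 + 1 = #J + #B. *)
rewrite mulr1 /tower_sign big_cons big_cons big_nil addn0 card_chain_set /=.
rewrite -exprD; congr (_ ^+ _)%R.
by move: #|B| #|` J| J1 => b j; lia.
Qed.

Lemma set0_setT_ord : (finset.setT == finset.set0 :> {set 'I_m}) = (m == 0%N).
Proof. by rewrite -cards_eq0 cardsT card_ord. Qed.

Lemma set0_positives : (positives == finset.set0) = (m <= 1)%N.
Proof.
apply/eqP/idP => [E|m1].
  rewrite leqNgt; apply/negP => m1; have := finset.in_set0 (Ordinal m1).
  by rewrite -E inE.
apply/setP => i; rewrite !inE; have := ltn_ord i; lia.
Qed.

Lemma term_nil : term [::] = (- ((d == 1%N)%:R *+ 3))%R.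
Proof.
by rewrite /term /tower_sign big_nil /tower_top deg_count_generators expr1 mulN1r.
Qed.

Lemma term1 (J : {fset M}) : (1 < #|` J|)%N ->
  term [:: J] = ((-1) ^+ #|` J| * deg_count d (mcm [set` J]))%R.
Proof.
move=> J1; rewrite /term /tower_sign big_seq1; congr (_ ^+ _ * _)%R.
by rewrite /= subnK // ltnW.
Qed.

Lemma skew_growthE :
  skew_growth (Gplus n) d =
  ((d == 0%N)%:R - (d == 1%N)%:R *+ 3 + (d == 2%N)%:R *+ 2
   + (d == n + 1)%N%:R - (d == n + 3)%N%:R)%R.
Proof.
have cab : #|` Jab| = 2 by rewrite cardfs2 ma_neq_mb.
have cac : #|` Jac| = 2 by rewrite cardfs2 ma_neq_mc.
have cbc : #|` Jbc| = 2 by rewrite cardfs2 eq_sym mc_neq_mb.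
have degab : deg (ma * mb) = 2 by rewrite -of_wordM deg_of_word.
have degac : deg (ma * mc) = 2 by rewrite -of_wordM deg_of_word.
rewrite skew_growth_towers /towers !big_cat !big_cons big_nil /=.
rewrite !term_chain_towers ?cbc ?cardJabc // set0_setT_ord set0_positives.
rewrite term_nil !term1 ?cab ?cac ?cbc ?cardJabc //.
rewrite mcm_ab mcm_ac mcm_bc mcm_abc !deg_count_set1 degab degac.
have -> : range chain = range (fun i => chain (i + 0)).
  by congr image; apply/funext => i; rewrite addn0.
have -> : range (fun i => chain i.+1) = range (fun i => chain (i + 1)).
  by congr image; apply/funext => i; rewrite addn1.
rewrite !deg_count_chain (eq_sym 2%N d).
(* At height 1, {b,c} and {a,b,c} have opposite signs, and only u_0 survives. *)
have <- : ((n + 1 + 0 <= d)%N%:R - (n + 1 + 1 <= d)%N%:R = (d == n + 1)%N%:R :> int)%R.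
  by case: (leqP (n + 1 + 0)); case: (leqP (n + 1 + 1)); case: eqP => //; lia.
(* At height 2 the two families differ only for m = 1. Truncation is harmless: for d at most n + 2
   both indicators are 1. *)
have <- : ((m <= 1)%N%:R - (m == 0%N)%:R = (d == n + 3)%N%:R :> int)%R.
  by rewrite /m; case: leqP; case: eqP; case: eqP => //; lia.
ring.
Qed.

End Degree.

End GplusMonoid.

Theorem mainTheorem2 (n : nat) (n_ge3 : (3 <= n)%N) (d : nat) :
  skew_growth (Gplus n) d =
  ((1 - 'X) * ('X^(n + 2) + 'X^(n + 1) - 'X *+ 2 + 1) : {poly int})`_d.
Proof.
rewrite (skew_growthE n_ge3).
have -> : ((1 - 'X) * ('X^(n + 2) + 'X^(n + 1) - 'X *+ 2 + 1) : {poly int}) =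
    1 - 'X *+ 3 + 'X^2 *+ 2 + 'X^(n + 1) - 'X^(n + 3).
  by rewrite !exprD; ring.
by rewrite !(coefD, coefN, coefMn, coefXn, coefX, coef1).
Qed.
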